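(* Let $q\in\mathbb C\setminus\{0\}$ with $q^2\neq-1$, let $\mathfrak R$ be an associative unital algebra over $\mathbb C$ and let $L\in\mathfrak R\otimes\mathrm{Hom}(\mathbb C^m,\mathbb C^n)$. The following statements are equivalent: (1) $R^q_nL^{(1)}L^{(2)}=L^{(2)}L^{(1)}R^q_m$; (2) $\widehat R^q_nL^{(1)}L^{(2)}=L^{(1)}L^{(2)}\widehat R^q_m$; (3) $\widehat R^q_{n+}L^{(1)}L^{(2)}=L^{(1)}L^{(2)}\widehat R^q_{m+}$; (4) $\widehat R^q_{n-}L^{(1)}L^{(2)}=L^{(1)}L^{(2)}\widehat R^q_{m-}$; (5) $A^q_nL^{(1)}L^{(2)}=L^{(2)}L^{(1)}A^q_m$; (6) $A^q_nL^{(1)}L^{(2)}S^q_m=0$ and $S^q_nL^{(2)}L^{(1)}A^q_m=0$; (7) the matrices $L$ and $L^\top$ are both $q$-Manin matrices.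
   Context: $E_i{}^j$ denotes the matrix unit with $1$ in row $i$ and column $j$. For an $n\times m$ matrix $L=(L^i_j)$ over $\mathfrak R$, $L^{(1)}L^{(2)}$ and $L^{(2)}L^{(1)}$ are the elements of $\mathfrak R\otimes\mathrm{Hom}(\mathbb C^m\otimes\mathbb C^m,\mathbb C^n\otimes\mathbb C^n)$ with entries $(L^{(1)}L^{(2)})^{ij}_{kl}=L^i_kL^j_l$ and $(L^{(2)}L^{(1)})^{ij}_{kl}=L^j_lL^i_k$ (row index $(i,j)$, column index $(k,l)$). $L^\top$ is the usual transposed matrix, with entries $(L^\top)^i_j=L^j_i$. Let $P_n\in\mathrm{End}(\mathbb C^n\otimes\mathbb C^n)$, $P_n(v\otimes w)=w\otimes v$. Put $$R^q_n=q^{-1}\sum_{i=1}^nE_i{}^i\otimes E_i{}^i+\sum_{i\ne j}E_i{}^i\otimes E_j{}^j+(q^{-1}-q)\sum_{i>j}E_i{}^j\otimes E_j{}^i,\qquad \widehat R^q_n=P_nR^q_n,$$ $$\widehat R^q_{n+}=\frac{q+\widehat R^q_n}{q+q^{-1}},\qquad \widehat R^q_{n-}=\frac{q^{-1}-\widehat R^q_n}{q+q^{-1}}.$$ Let $P^q_n=\sum_{i,j=1}^nq^{\mathrm{sgn}(i-j)}E_i{}^j\otimes E_j{}^i$ with $\mathrm{sgn}(0)=0$, $A^q_n=\frac12(1-P^q_n)$, $S^q_n=\frac12(1+P^q_n)$. An $n\times m$ matrix $M$ over $\mathfrak R$ is called a $q$-Manin matrix if $A^q_nM^{(1)}M^{(2)}S^q_m=0$.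 *)

(* Defs.v *)
From mathcomp Require Import all_boot all_order all_algebra.
From mathcomp Require Import reals.
From mathcomp.real_closed Require Export complex mxtens.

Set Implicit Arguments.
Unset Strict Implicit.
Unset Printing Implicit Defensive.

Import GRing.Theory.
Local Open Scope ring_scope.

(* Hom(F^m (x) F^m, F^n (x) F^n) is 'M[F]_(n * n, m * m) acting on column
   vectors: rows are indexed by pairs (i, j) and columns by pairs (k, l), both
   encoded by mxtens_index, so that *t is the tensor product. *)

Section Coefficients.
Variables (F : fieldType) (n : nat).
Implicit Types q : F.

Local Notation E i j := (delta_mx i j : 'M[F]_n).

Definition flip : 'M[F]_(n * n) :=
  \matrix_(s, t) ((mxtens_unindex s == ((mxtens_unindex t).2,
                                        (mxtens_unindex t).1))%:R).

Lemma flip_tens (v w : 'cV[F]_n) : flip *m (v *t w) = w *t v.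
Proof.
apply/matrixP=> s t; case: (mxtens_indexP s) => i j.
case: (mxtens_indexP t) => a b; rewrite tensmxE mxE.
rewrite (bigD1 (mxtens_index (j, i))) //= big1 => [|u].
  by rewrite tensmxE mxE !mxtens_indexK eqxx mul1r addr0 mulrC [a]ord1 [b]ord1.
case: (mxtens_indexP u) => k l neq; rewrite tensmxE mxE !mxtens_indexK /=.
case: eqP => [[ei ej]|_]; last by rewrite mul0r.
by rewrite ei ej eqxx in neq.
Qed.

Definition Rmx q : 'M[F]_(n * n) :=
  q^-1 *: (\sum_(i < n) E i i *t E i i)
  + \sum_(i < n) \sum_(j < n | i != j) E i i *t E j j
  + (q^-1 - q) *: (\sum_(i < n) \sum_(j < n | (j < i)%N) E i j *t E j i).

Definition Rhat q : 'M[F]_(n * n) := flip *m Rmx q.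

Definition Rhat_plus q : 'M[F]_(n * n) :=
  (q + q^-1)^-1 *: (q%:M + Rhat q).

Definition Rhat_minus q : 'M[F]_(n * n) :=
  (q + q^-1)^-1 *: (q^-1%:M - Rhat q).

Definition qflip q : 'M[F]_(n * n) :=
  \sum_(i < n) \sum_(j < n) (q ^ sgz (i%:Z - j%:Z)) *: (E i j *t E j i).

Definition Aq q : 'M[F]_(n * n) := 2%:R^-1 *: (1%:M - qflip q).

Definition Sq q : 'M[F]_(n * n) := 2%:R^-1 *: (1%:M + qflip q).

End Coefficients.

Section Products.
Variables (F : fieldType) (A : algType F).

Definition scalar_mx_in n m (X : 'M[F]_(n, m)) : 'M[A]_(n, m) :=
  map_mx (fun c => c%:A) X.

Definition L12 n m (L : 'M[A]_(n, m)) : 'M[A]_(n * n, m * m) :=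
  \matrix_(s, t) (L (mxtens_unindex s).1 (mxtens_unindex t).1
                  * L (mxtens_unindex s).2 (mxtens_unindex t).2).

(* The order of the two factors matters: A is not assumed commutative. *)
Definition L21 n m (L : 'M[A]_(n, m)) : 'M[A]_(n * n, m * m) :=
  \matrix_(s, t) (L (mxtens_unindex s).2 (mxtens_unindex t).2
                  * L (mxtens_unindex s).1 (mxtens_unindex t).1).

Definition qManin (q : F) n m (M : 'M[A]_(n, m)) : Prop :=
  scalar_mx_in (Aq n q) *m L12 M *m scalar_mx_in (Sq m q) = 0.

End Products.

Arguments scalar_mx_in {F} A {n m} X.

(* Main.v *)
(* With [P] the flip, [P *m L12 L = L21 L *m P], so intertwining relations are
   unchanged when one adds multiples of [P] (or of [1], when both sides carry
   [L12 L]) or multiplies by [P]. Since [Rmx = 2 Aq + q^-1 P], this settles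
   (1)-(5). For (6), the Hecke-type identity
   [Aq P Aq = - (q + q^-1) / 2 Aq] makes [Rhat_minus = - 2 / (q + q^-1) P Aq] an
   idempotent; the two equations of (6) say that [L12 L] preserves its kernel
   and its image, which is (4). Finally (7) is (6) because transposition
   conjugates [Aq] and [Sq] by [P]. *)

Require Import Defs.
From mathcomp Require Import all_boot all_order all_algebra.
From mathcomp Require Import fingroup perm ring.
From mathcomp Require Import reals.

Set Implicit Arguments.
Unset Strict Implicit.
Unset Printing Implicit Defensive.

Import Order.TTheory GRing.Theory Num.Theory.
Local Open Scope ring_scope.

(** * Exchange of the two tensor factors on indices *)

Section Swap.
Variable n : nat.

Definition swap (s : 'I_(n * n)) : 'I_(n * n) :=
  mxtens_index ((mxtens_unindex s).2, (mxtens_unindex s).1).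

Lemma swap_index i j : swap (mxtens_index (i, j)) = mxtens_index (j, i).
Proof. by rewrite /swap mxtens_indexK. Qed.

Lemma swapK : involutive swap.
Proof. by move=> s; case: (mxtens_indexP s) => i j; rewrite !swap_index. Qed.

Definition swap_perm : 'S_(n * n) := perm (inv_inj swapK).

Lemma swap_permV : (swap_perm^-1)%g = swap_perm.
Proof.
apply: (mulgI swap_perm); rewrite mulgV; apply/permP=> s.
by rewrite permM !permE swapK.
Qed.

End Swap.

(** * Identities for the flip, the q-flip and the R-matrix over the ground field *)

Section TensorSquare.
Variables (F : fieldType) (n : nat) (q : F).
Local Notation P := (flip F n).
Local Notation Q := (qflip n q).
Local Notation E i j := (delta_mx i j : 'M[F]_n).

(** As a permutation matrix, [flip] acts by reindexing rows or columns, and inherits involutivity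
    and symmetry from [swap_perm]. *)
Lemma flipE : P = perm_mx (swap_perm n).
Proof.
apply/matrixP=> s t; rewrite !mxE permE.
case: (mxtens_indexP s) => i j; case: (mxtens_indexP t) => k l.
rewrite !mxtens_indexK swap_index (can_eq (@mxtens_indexK n n)) /=.
by rewrite !xpair_eqE andbC.
Qed.

Lemma flip_mul m (X : 'M[F]_(n * n, m)) i j t :
  (P *m X) (mxtens_index (i, j)) t = X (mxtens_index (j, i)) t.
Proof. by rewrite flipE -row_permE mxE permE swap_index. Qed.

Lemma flip_invol : P *m P = 1%:M.
Proof. by rewrite flipE -perm_mxM -{1}swap_permV mulVg perm_mx1. Qed.

Lemma trmx_flip : P^T = P.
Proof. by rewrite flipE tr_perm_mx swap_permV. Qed.

Lemma tens_deltaE i1 j1 i2 j2 i j k l :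
  (E i1 j1 *t E i2 j2) (mxtens_index (i, j)) (mxtens_index (k, l)) =
  ((i == i1) && (j == i2) && ((k == j1) && (l == j2)))%:R.
Proof.
rewrite tensmxE !mxE -natrM mulnb.
by case: (i == i1); case: (j == i2); case: (k == j1).
Qed.

(** The summand at (a, b) lives in row (a, b) alone, so row (i, j) meets at most one summand. This
    covers the q-flip and the three sums of [Rmx]. *)
Lemma sum_tens_deltaE (I : rel 'I_n) (c : 'I_n -> 'I_n -> F)
    (f g : 'I_n -> 'I_n -> 'I_n) i j k l :
  (\sum_(a < n) \sum_(b < n | I a b) c a b *: (E a (f a b) *t E b (g a b)))
    (mxtens_index (i, j)) (mxtens_index (k, l)) =
  c i j *+ (I i j && ((k == f i j) && (l == g i j))).
Proof.
rewrite summxE (bigD1 i) //= [X in _ + X]big1 ?addr0 => [|a /negPf nai].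
  rewrite summxE; case Iij: (I i j); last first.
    rewrite big1 // => b Iib; rewrite mxE tens_deltaE.
    have /negPf->: j != b by apply: contraTneq Iib => <-; rewrite Iij.
    by rewrite andbF mulr0.
  rewrite (bigD1 j) //= big1 ?addr0 => [|b /andP[_ /negPf nbj]].
    by rewrite mxE tens_deltaE !eqxx mulr_natr.
  by rewrite mxE tens_deltaE [j == b]eq_sym nbj andbF mulr0.
rewrite summxE big1 // => b _.
by rewrite mxE tens_deltaE [i == a]eq_sym nai mulr0.
Qed.

Definition qsgn (i j : 'I_n) : F := q ^ sgz (i%:Z - j%:Z).

Lemma qsgnE i j :
  qsgn i j = if (i < j)%N then q^-1 else if (j < i)%N then q else 1.
Proof.
rewrite /qsgn; case: ltngtP => [ltij|ltji|->]; last by rewrite subrr.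
  by rewrite ltr0_sgz // subr_lt0.
by rewrite gtr0_sgz // subr_gt0.
Qed.

Lemma qsgnV i j : qsgn j i = (qsgn i j)^-1.
Proof. by rewrite !qsgnE; case: ltngtP; rewrite ?invrK ?invr1. Qed.

Lemma qflip_entry i j k l :
  Q (mxtens_index (i, j)) (mxtens_index (k, l)) =
  qsgn i j *+ ((k == j) && (l == i)).
Proof.
by rewrite (@sum_tens_deltaE (fun _ _ => true) qsgn (fun _ b => b)
              (fun a _ => a)).
Qed.

Definition qsgn_mx : 'M[F]_(n * n) :=
  diag_mx (\row_s qsgn (mxtens_unindex s).1 (mxtens_unindex s).2).

Lemma qsgn_mul m (X : 'M[F]_(n * n, m)) i j t :
  (qsgn_mx *m X) (mxtens_index (i, j)) t
  = qsgn i j * X (mxtens_index (i, j)) t.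
Proof. by rewrite mul_diag_mx !mxE mxtens_indexK. Qed.

Lemma qflipE : Q = qsgn_mx *m P.
Proof.
apply/matrixP=> s t; case: (mxtens_indexP s) => i j.
case: (mxtens_indexP t) => k l; rewrite qflip_entry qsgn_mul.
by rewrite mxE !mxtens_indexK xpair_eqE /= mulr_natr andbC
           [i == l]eq_sym [j == k]eq_sym.
Qed.

Lemma qflip_mul m (X : 'M[F]_(n * n, m)) i j t :
  (Q *m X) (mxtens_index (i, j)) t = qsgn i j * X (mxtens_index (j, i)) t.
Proof. by rewrite qflipE -mulmxA qsgn_mul flip_mul. Qed.

Hypothesis q_neq0 : q != 0.

Lemma qsgn_neq0 i j : qsgn i j != 0.
Proof. exact: expfz_neq0. Qed.

Lemma qflip_invol : Q *m Q = 1%:M.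
Proof.
apply/matrixP=> s t; case: (mxtens_indexP s) => i j.
rewrite qflip_mul -[Q]mulmx1 qflip_mul mulrA (qsgnV i j).
by rewrite divff ?qsgn_neq0 ?mul1r.
Qed.

(** Since Q = D P with D diagonal and P symmetric, the transpose is P D = P Q P. *)
Lemma trmx_qflip : Q^T = P *m Q *m P.
Proof.
rewrite qflipE trmx_mul tr_diag_mx trmx_flip -!mulmxA flip_invol.
by rewrite mulmx1.
Qed.

Hypothesis two_neq0 : 2%:R != 0 :> F.

(** For i != j, the right-hand side has at row (i, j), column (j, i) the entry q^-1 - q^sgn(i - j),
    which is q^-1 - q if i > j and 0 if i < j. *)
Lemma Rmx_Aq : Rmx n q = 2%:R *: Aq n q + q^-1 *: P.
Proof.
rewrite /Aq scalerA divff // scale1r.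
have -> : Rmx n q =
    q^-1 *: (\sum_(a < n) \sum_(b < n | a == b) 1 *: (E a a *t E b b))
    + (\sum_(a < n) \sum_(b < n | a != b) 1 *: (E a a *t E b b))
    + (q^-1 - q)
      *: (\sum_(a < n) \sum_(b < n | (b < a)%N) 1 *: (E a b *t E b a)).
  congr (_ *: _ + _ + _ *: _); apply: eq_bigr => a _.
  - by rewrite (big_pred1 a) ?scale1r // => b; rewrite eq_sym.
  - by apply: eq_bigr => b _; rewrite scale1r.
  - by apply: eq_bigr => b _; rewrite scale1r.
apply/matrixP=> s t; case: (mxtens_indexP s) => i j.
case: (mxtens_indexP t) => k l.
rewrite [LHS]mxE [X in X + _]mxE [X in _ + X]mxE [X in X + _ + _]mxE.
rewrite !sum_tens_deltaE !mxE qflip_entry !mxtens_indexK /=.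
rewrite (can_eq (@mxtens_indexK n n)) !xpair_eqE qsgnE -(val_eqE i j) /=.
rewrite [k == i]eq_sym [l == j]eq_sym [k == j]eq_sym [l == i]eq_sym.
case: ltngtP => [_|_|/val_inj->] /=; case: (j == k); case: (j == l) => //=;
  case: (i == k); case: (i == l); rewrite /= ?mulr0n ?mulr1n; ring.
Qed.

Lemma Aq_mul m (X : 'M[F]_(n * n, m)) i j t :
  (Aq n q *m X) (mxtens_index (i, j)) t =
  2%:R^-1 * (X (mxtens_index (i, j)) t
             - qsgn i j * X (mxtens_index (j, i)) t).
Proof.
by rewrite /Aq -scalemxAl mulmxBl mul1mx [LHS]mxE [X in _ * X]mxE
           [X in _ + X]mxE qflip_mul.
Qed.

(* [qsgn i j + qsgn j i] is [q + q^-1] off the diagonal, and row [(i, i)] of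
   [Aq n q] vanishes. *)
Lemma Aq_hecke :
  Aq n q *m P *m Aq n q = (- (2%:R^-1 * (q + q^-1))) *: Aq n q.
Proof.
apply/matrixP=> s t; case: (mxtens_indexP s) => i j.
rewrite -mulmxA Aq_mul !flip_mul [RHS]mxE -[Aq n q]mulmx1 !Aq_mul.
rewrite (qsgnV i j) qsgnE.
case: ltngtP => [_|_|/val_inj->]; field;
  by rewrite ?q_neq0 ?two_neq0 ?oner_neq0.
Qed.

Lemma AqDSq : Aq n q + Sq n q = 1%:M.
Proof.
rewrite /Aq /Sq -scalerDr addrACA addNr addr0 -mulr2n -scaler_nat scalerA.
by rewrite mulVf // scale1r.
Qed.

(** (1 - Q)(1 + Q) = 1 - Q^2 vanishes because Q is an involution. With [AqDSq], this makes [Aq] and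
    [Sq] complementary idempotents. *)
Lemma Aq_Sq : Aq n q *m Sq n q = 0.
Proof.
rewrite /Aq /Sq -scalemxAl -scalemxAr mulmxBl !mulmxDr !mulmx1 mul1mx.
by rewrite qflip_invol addrKA subrr !scaler0.
Qed.

Lemma Sq_Aq : Sq n q *m Aq n q = 0.
Proof.
rewrite /Aq /Sq -scalemxAl -scalemxAr mulmxDl !mulmxBr !mulmx1 mul1mx.
by rewrite qflip_invol -[Q - _]opprB subrr !scaler0.
Qed.

Lemma trmx_Aq : (Aq n q)^T = P *m Aq n q *m P.
Proof.
rewrite /Aq linearZ /= linearB /= trmx1 trmx_qflip.
by rewrite -scalemxAr -scalemxAl mulmxBr mulmxBl mulmx1 flip_invol.
Qed.

Lemma trmx_Sq : (Sq n q)^T = P *m Sq n q *m P.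
Proof.
rewrite /Sq linearZ /= linearD /= trmx1 trmx_qflip.
by rewrite -scalemxAr -scalemxAl mulmxDr mulmxDl mulmx1 flip_invol.
Qed.

Hypothesis qDV_neq0 : q + q^-1 != 0.

(** By [Rmx_Aq] and P^2 = 1, [Rhat] is 2 P Aq + q^-1, whose constant cancels the one in
    [Rhat_minus]. *)
Lemma Rhat_minusE : Rhat_minus n q = (- (2%:R / (q + q^-1))) *: (P *m Aq n q).
Proof.
rewrite /Rhat_minus /Rhat Rmx_Aq mulmxDr -[P *m (_ *: P)]scalemxAr flip_invol.
rewrite -scalemxAr scalemx1 opprD [_%:M + _]addrC subrK.
by rewrite scalerN scalerA scaleNr mulrC.
Qed.

(** The Hecke constant is inverse to the factor in [Rhat_minusE]. Hence the kernel of [Rhat_minus]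
    lies in that of [Aq]; the converse inclusion is [Rhat_minusE]. *)
Lemma Aq_Rhat_minus : Aq n q *m Rhat_minus n q = Aq n q.
Proof.
rewrite Rhat_minusE -scalemxAr mulmxA Aq_hecke scalerA mulrNN.
by rewrite mulrACA divff // mulVf // mulr1 scale1r.
Qed.

(** As P is invertible, P Aq P has the same image as P Aq, that is, as [Rhat_minus], which acts on
    it as the identity. *)
Lemma Rhat_minus_flip_Aq :
  Rhat_minus n q *m (P *m Aq n q *m P) = P *m Aq n q *m P.
Proof.
rewrite Rhat_minusE -scalemxAl -!mulmxA (mulmxA (Aq n q)) (mulmxA _ (Aq n q)).
rewrite Aq_hecke -scalemxAl -scalemxAr scalerA mulrNN.
by rewrite mulrACA divff // mulVf // mulr1 scale1r.
Qed.

End TensorSquare.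

(** * Scalar matrices over the noncommutative algebra *)

Section ScalarMatrices.
Variables (F : fieldType) (A : algType F).

Lemma scalar_mx_in1 n : scalar_mx_in A (1%:M : 'M[F]_n) = 1%:M.
Proof. exact: (map_mx1 (in_alg A)). Qed.

Lemma scalar_mx_inM n m p (X : 'M[F]_(n, m)) (Y : 'M[F]_(m, p)) :
  scalar_mx_in A (X *m Y) = scalar_mx_in A X *m scalar_mx_in A Y.
Proof. exact: (map_mxM (in_alg A)). Qed.

Lemma scalar_mx_inD n m (X Y : 'M[F]_(n, m)) :
  scalar_mx_in A (X + Y) = scalar_mx_in A X + scalar_mx_in A Y.
Proof. exact: (map_mxD (in_alg A)). Qed.

Lemma scalar_mx_inZ n m c (X : 'M[F]_(n, m)) :
  scalar_mx_in A (c *: X) = c%:A *: scalar_mx_in A X.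
Proof. exact: (map_mxZ (in_alg A)). Qed.

Lemma scalar_mx_in0 n m : scalar_mx_in A (0 : 'M[F]_(n, m)) = 0.
Proof. exact: (map_mx0 (in_alg A)). Qed.

(** The scalar passes through [X] because [c%:A] is central, although [A] need not be
    commutative. *)
Lemma mul_scalar_mx_inZ n m p (c : F) (X : 'M[A]_(n, m)) (Y : 'M[F]_(m, p)) :
  X *m scalar_mx_in A (c *: Y) = c%:A *: (X *m scalar_mx_in A Y).
Proof.
apply/matrixP=> i j; rewrite !mxE mulr_sumr; apply: eq_bigr => k _.
by rewrite !mxE !mulr_algr !mulr_algl scalerA.
Qed.

(** Transposition reverses this product over a noncommutative [A] because one factor has central
    entries. *)
Lemma trmx_scalar_mul n m p (Y : 'M[F]_(n, m)) (X : 'M[A]_(m, p)) :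
  (scalar_mx_in A Y *m X)^T = X^T *m scalar_mx_in A Y^T.
Proof.
apply/matrixP=> i j; rewrite !mxE; apply: eq_bigr => k _.
by rewrite !mxE mulr_algl mulr_algr.
Qed.

Lemma trmx_mul_scalar n m p (X : 'M[A]_(n, m)) (Y : 'M[F]_(m, p)) :
  (X *m scalar_mx_in A Y)^T = scalar_mx_in A Y^T *m X^T.
Proof.
apply/matrixP=> i j; rewrite !mxE; apply: eq_bigr => k _.
by rewrite !mxE mulr_algl mulr_algr.
Qed.

Lemma intertwine_scalar n m (c : F) (X : 'M[A]_(n, m)) :
  scalar_mx_in A c%:M *m X = X *m scalar_mx_in A c%:M.
Proof.
rewrite -(scalemx1 n c) -(scalemx1 m c) mul_scalar_mx_inZ scalar_mx_inZ -scalemxAl.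
by rewrite !scalar_mx_in1 mulmx1 mul1mx.
Qed.

(** It is applied with [X = W = L12 L] and [Z] scalar to pass between (2), (3) and (4), and with
    [W = L21 L] and [Z] a multiple of the flip to link (1) and (5). *)
Lemma intertwine_affine n m (c : F) (Y Z : 'M[F]_n) (Y' Z' : 'M[F]_m)
    (X W : 'M[A]_(n, m)) :
  c != 0 -> scalar_mx_in A Z *m X = W *m scalar_mx_in A Z' ->
  scalar_mx_in A (c *: Y + Z) *m X = W *m scalar_mx_in A (c *: Y' + Z') <->
  scalar_mx_in A Y *m X = W *m scalar_mx_in A Y'.
Proof.
move=> c_neq0 ZX; rewrite !scalar_mx_inD mulmxDl mulmxDr ZX.
rewrite mul_scalar_mx_inZ scalar_mx_inZ -scalemxAl.
split=> [/addIr eqYX | -> //].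
move/(congr1 (fun M => c^-1%:A *: M)): eqYX.
by rewrite !scalerA mulr_algl scalerA mulVf // !scale1r.
Qed.

(** At row (i, j), column (k, l), both sides are L^j_k L^i_l with the factors in this order, so no
    commutation in [A] is involved. *)
Lemma flip_L12 n m (L : 'M[A]_(n, m)) :
  scalar_mx_in A (flip F n) *m L12 L = L21 L *m scalar_mx_in A (flip F m).
Proof.
rewrite !flipE /scalar_mx_in !(map_perm_mx (in_alg A)) -row_permE.
rewrite -{1}[swap_perm m]swap_permV -col_permE.
apply/matrixP=> s t; case: (mxtens_indexP s) => i j.
case: (mxtens_indexP t) => k l.
by rewrite !mxE !permE !swap_index !mxtens_indexK.
Qed.

(** Only the indices are exchanged; the order of the factors is kept, so [L12] reappears rather than
    [L21]. *)
Lemma trmx_L12 n m (L : 'M[A]_(n, m)) : (L12 L^T)^T = L12 L.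
Proof. by apply/matrixP=> s t; rewrite !mxE. Qed.

Lemma flip_in_invol n :
  scalar_mx_in A (flip F n) *m scalar_mx_in A (flip F n) = 1%:M.
Proof. by rewrite -scalar_mx_inM flip_invol scalar_mx_in1. Qed.

Lemma L21E n m (L : 'M[A]_(n, m)) :
  L21 L = scalar_mx_in A (flip F n) *m L12 L *m scalar_mx_in A (flip F m).
Proof. by rewrite flip_L12 -mulmxA flip_in_invol mulmx1. Qed.

Lemma mulmx_flip_inj n m (X Y : 'M[A]_(n * n, m)) :
  scalar_mx_in A (flip F n) *m X = scalar_mx_in A (flip F n) *m Y -> X = Y.
Proof.
move/(congr1 (mulmx (scalar_mx_in A (flip F n)))).
by rewrite !mulmxA flip_in_invol !mul1mx.
Qed.

End ScalarMatrices.

(** * Equivalences between the conditions on L *)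

Section Equivalences.
Variables (F : fieldType) (q : F) (A : algType F) (n m : nat).
Variable L : 'M[A]_(n, m).
Hypotheses (q_neq0 : q != 0) (two_neq0 : 2%:R != 0 :> F).
Hypothesis qDV_neq0 : q + q^-1 != 0.
Local Notation "X %:S" := (scalar_mx_in A X)
  (at level 2, left associativity, format "X %:S").

Lemma Rmx_Rhat :
  (Rmx n q)%:S *m L12 L = L21 L *m (Rmx m q)%:S <->
  (Rhat n q)%:S *m L12 L = L12 L *m (Rhat m q)%:S.
Proof.
have flipL21: (flip F n)%:S *m L21 L = L12 L *m (flip F m)%:S.
  by rewrite L21E !mulmxA flip_in_invol mul1mx.
rewrite /Rhat !scalar_mx_inM (mulmxA (L12 L)) -flipL21 -!mulmxA.
by split=> [-> | /mulmx_flip_inj].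
Qed.

Lemma Rhat_Rhat_plus :
  (Rhat n q)%:S *m L12 L = L12 L *m (Rhat m q)%:S <->
  (Rhat_plus n q)%:S *m L12 L = L12 L *m (Rhat_plus m q)%:S.
Proof.
apply: iff_sym; rewrite /Rhat_plus !scalerDr ![_ *: q%:M + _]addrC.
rewrite !scale_scalar_mx.
by apply: intertwine_affine; [rewrite invr_neq0 | exact: intertwine_scalar].
Qed.

Lemma Rhat_Rhat_minus :
  (Rhat n q)%:S *m L12 L = L12 L *m (Rhat m q)%:S <->
  (Rhat_minus n q)%:S *m L12 L = L12 L *m (Rhat_minus m q)%:S.
Proof.
apply: iff_sym; rewrite /Rhat_minus !scalerBr ![_ *: q^-1%:M - _]addrC.
rewrite -!scaleNr !scale_scalar_mx.
by apply: intertwine_affine;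
  [rewrite oppr_eq0 invr_neq0 | exact: intertwine_scalar].
Qed.

Lemma Rmx_intertwine_Aq :
  (Rmx n q)%:S *m L12 L = L21 L *m (Rmx m q)%:S <->
  (Aq n q)%:S *m L12 L = L21 L *m (Aq m q)%:S.
Proof.
rewrite !Rmx_Aq //; apply: intertwine_affine => //.
by rewrite mul_scalar_mx_inZ scalar_mx_inZ -scalemxAl flip_L12.
Qed.

(** Moving [Aq] to the other side of the product in L puts it next to [Sq], which it annihilates. *)
Lemma Aq_orthogonality :
  (Aq n q)%:S *m L12 L = L21 L *m (Aq m q)%:S ->
  (Aq n q)%:S *m L12 L *m (Sq m q)%:S = 0 /\
  (Sq n q)%:S *m L21 L *m (Aq m q)%:S = 0.
Proof.
move=> AL; split.
  by rewrite AL -mulmxA -scalar_mx_inM Aq_Sq // scalar_mx_in0 mulmx0.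
by rewrite -mulmxA -AL mulmxA -scalar_mx_inM Sq_Aq // scalar_mx_in0 mul0mx.
Qed.

(* [Rhat_minus] is an idempotent with the same kernel as [Aq] and the same
   image as [flip *m Aq *m flip]; the two hypotheses say that [L12 L] sends the
   kernel into the kernel and the image into the image. *)
Lemma Rhat_minus_of_orthogonality :
  (Aq n q)%:S *m L12 L *m (Sq m q)%:S = 0 ->
  (Sq n q)%:S *m L21 L *m (Aq m q)%:S = 0 ->
  (Rhat_minus n q)%:S *m L12 L = L12 L *m (Rhat_minus m q)%:S.
Proof.
move=> ALS SLA; set T := L12 L.
(* Inserting [Aq + Sq = 1] on the right here, and on the left in [LA], turns each vanishing
   condition into an absorption rule. *)
have ALA: (Aq n q)%:S *m T *m (Aq m q)%:S = (Aq n q)%:S *m T.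
  rewrite -[RHS]mulmx1 -scalar_mx_in1 -(AqDSq m q two_neq0).
  by rewrite scalar_mx_inD mulmxDr ALS addr0.
have LA: (Aq n q)%:S *m L21 L *m (Aq m q)%:S = L21 L *m (Aq m q)%:S.
  rewrite -[RHS]mul1mx -scalar_mx_in1 -(AqDSq n q two_neq0).
  by rewrite scalar_mx_inD mulmxDl !mulmxA SLA addr0.
have AT: (Aq n q)%:S *m T *m (Rhat_minus m q)%:S = (Aq n q)%:S *m T.
  by rewrite -ALA -!mulmxA -scalar_mx_inM Aq_Rhat_minus.
(* Preservation of the kernel ([AT]) gives the first equality, preservation of the image ([PAP]) the
   second. *)
transitivity ((Rhat_minus n q)%:S *m T *m (Rhat_minus m q)%:S).
  rewrite Rhat_minusE // scalemxAl scalar_mx_inM -!mulmxA; congr (_ *m _).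
  by rewrite mulmxA AT.
(* Multiplied by the flip on the left, this is [LA]. *)
have PAP : (flip F n *m Aq n q *m flip F n)%:S *m T *m (flip F m *m Aq m q)%:S
    = T *m (flip F m *m Aq m q)%:S.
  apply: (@mulmx_flip_inj F).
  rewrite !scalar_mx_inM !mulmxA flip_in_invol mul1mx.
  by move: LA; rewrite L21E !mulmxA.
rewrite [Rhat_minus m q]Rhat_minusE // -mul_mx_scalar scalar_mx_inM !mulmxA.
rewrite -[_ *m T *m _]mulmxA -PAP !mulmxA -scalar_mx_inM.
by rewrite Rhat_minus_flip_Aq.
Qed.

(** Transposing the condition on [L^T] swaps the outer factors and conjugates them by flips; the
    inner flips turn [L12] into [L21] and the outer ones are invertible. *)
Lemma qManin_trmx :
  qManin q L^T <-> (Sq n q)%:S *m L21 L *m (Aq m q)%:S = 0.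
Proof.
have trE : ((Aq m q)%:S *m L12 L^T *m (Sq n q)%:S)^T =
    (flip F n)%:S *m ((Sq n q)%:S *m L21 L *m (Aq m q)%:S) *m (flip F m)%:S.
  rewrite trmx_mul_scalar trmx_scalar_mul trmx_L12 trmx_Aq trmx_Sq L21E.
  by rewrite !scalar_mx_inM !mulmxA.
split=> [LT0 | SLA]; last first.
  by apply: trmx_inj; rewrite trE SLA mulmx0 mul0mx trmx0.
move: trE; rewrite LT0 trmx0 -mulmxA => /esym.
rewrite -[RHS](mulmx0 _ (flip F n)%:S).
move/mulmx_flip_inj/(congr1 (mulmxr (flip F m)%:S)) => /=.
by rewrite mul0mx -[LHS]mulmxA flip_in_invol mulmx1.
Qed.

End Equivalences.

Theorem theorem4p4 (R : realType) (q : R[i]) (q_neq0 : q != 0)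
    (q2_neqN1 : q ^+ 2 != -1) (A : algType R[i]) (n m : nat)
    (L : 'M[A]_(n, m)) :
  [<-> (* 1 *) scalar_mx_in A (Rmx n q) *m L12 L
               = L21 L *m scalar_mx_in A (Rmx m q);
       (* 2 *) scalar_mx_in A (Rhat n q) *m L12 L
               = L12 L *m scalar_mx_in A (Rhat m q);
       (* 3 *) scalar_mx_in A (Rhat_plus n q) *m L12 L
               = L12 L *m scalar_mx_in A (Rhat_plus m q);
       (* 4 *) scalar_mx_in A (Rhat_minus n q) *m L12 L
               = L12 L *m scalar_mx_in A (Rhat_minus m q);
       (* 5 *) scalar_mx_in A (Aq n q) *m L12 L
               = L21 L *m scalar_mx_in A (Aq m q);
       (* 6 *) scalar_mx_in A (Aq n q) *m L12 L *m scalar_mx_in A (Sq m q) = 0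
               /\ scalar_mx_in A (Sq n q) *m L21 L *m scalar_mx_in A (Aq m q)
                  = 0;
       (* 7 *) qManin q L /\ qManin q L^T].
Proof.
have two_neq0 : 2%:R != 0 :> R[i] by rewrite pnatr_eq0.
have qDV_neq0 : q + q^-1 != 0.
  (* Multiplying q + q^-1 = 0 by q gives q^2 = -1. *)
  apply: contraNneq q2_neqN1 => /(congr1 ( *%R q)).
  by rewrite mulrDr divff // mulr0 expr2 => /eqP; rewrite addr_eq0.
have e12 := Rmx_Rhat q L; have e23 := Rhat_Rhat_plus L qDV_neq0.
have e24 := Rhat_Rhat_minus L qDV_neq0.
have e15 := Rmx_intertwine_Aq q L two_neq0.
have i56 := Aq_orthogonality q_neq0 (L := L).
have i64 := Rhat_minus_of_orthogonality q_neq0 two_neq0 qDV_neq0 (L := L).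
have e67 := qManin_trmx q L.
tfae.
- exact: (iffLR e12).
- exact: (iffLR e23).
- by move=> h3; apply: (iffLR e24); apply: (iffRL e23).
- move=> h4; apply: (iffLR e15); apply: (iffRL e12); exact: (iffRL e24).
- exact: i56.
(* The first equation of (6) is by definition the q-Manin condition on [L]. *)
- by case=> ALS SLA; split; [exact: ALS | exact: (iffRL e67)].
- case=> ALS LT; apply: (iffRL e12); apply: (iffRL e24).
  by apply: i64; [exact: ALS | exact: (iffLR e67)].
Qed.
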